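(* Let $L$ be a line. (1) If $L$ is described by $y=ax+b$, where $b\neq 0$, then $\iota(L)$ is a circle described by the equation $$\left(x+\frac{a}{2b}\right)^2 + \left(y+\frac{1}{2b}\right)^2 = \left(\frac{\sqrt{1+a^2}}{2b}\right)^2.$$ (2) If $L$ is described by $y=ax$, then $\iota(L)=\{z\in\overline{\mathbb{C}}\setminus\{0\} : y=-ax\}$. (3) If $L$ is described by $x=c\neq 0$, then $\iota(L)$ is a circle described by the equation $$\left(x-\frac{1}{2c}\right)^2 + y^2 = \left(\frac{1}{2c}\right)^2.$$ (4) If $L$ is described by $x=0$, then $\iota(L)=\{z\in\overline{\mathbb{C}}\setminus\{0\} : x=0\}$.
   Context: $\overline{\mathbb{C}}=\mathbb{C}\cup\{\infty\}$ is the Riemann sphere and $\iota:\overline{\mathbb{C}}\to\overline{\mathbb{C}}$ is the inversion $\iota(z)=z^{-1}$ with $\iota(0)=\infty$ and $\iota(\infty)=0$. Points are written $z=x+iy$ with $x,y$ real, and $a,b,c$ are real numbers.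
   Formalization: No single convention on whether ∞ lies on L makes all four items true; the formal theorem gives (1),(3) as stated for L with ∞ (without ∞ the image is the circle minus 0) and (2),(4) as stated for L without ∞ (with ∞ the image also contains 0), ∞ counting as a solution of line equations. *)

(* Defs.v *)
From mathcomp Require Import all_boot all_order all_algebra.
From mathcomp Require Import all_classical all_reals all_analysis.
From mathcomp Require Export complex.

Set Implicit Arguments.
Unset Strict Implicit.
Unset Printing Implicit Defensive.

Import Order.TTheory GRing.Theory Num.Theory.
Local Open Scope classical_set_scope.
Local Open Scope ring_scope.
Local Open Scope complex_scope.

Definition sphere (R : realType) : Type := one_point_compactification R[i].

Definition fin_pt (R : realType) (z : R[i]) : sphere R := Some z.
Definition infty_pt (R : realType) : sphere R := None.

(* The test z == 0 is needed because 0^-1 = 0 in MathComp. *)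
Definition iota_inv (R : realType) (w : sphere R) : sphere R :=
  match w with
  | Some z => if z == 0 then infty_pt R else fin_pt z^-1
  | None => fin_pt 0
  end.

(* A set of complex numbers seen in the sphere, without the point at infinity
   [in_sphere] and with it [with_infty].  If A is given by the equation of a
   line, then with_infty A is the set of points of the sphere described by that
   equation, the point at infinity being counted as lying on every line. *)
Definition in_sphere (R : realType) (A : set R[i]) : set (sphere R) :=
  [set fin_pt z | z in A].

Definition with_infty (R : realType) (A : set R[i]) : set (sphere R) :=
  in_sphere A `|` [set infty_pt R].

Definition is_line (R : realType) (L : set R[i]) : Prop :=
  exists p v : R[i], v != 0 /\ L = [set p + t%:C * v | t in [set: R]].

Definition is_circle (R : realType) (S : set (sphere R)) : Prop :=
  exists (p : R[i]) (r : R),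
    0 < r /\ S = in_sphere [set z | `|z - p| = r%:C].

(* Main.v *)
(* Every line is p x + q y = r.  Evaluating this equation at 1/z = (x - iy)/|z|^2
   and multiplying by |z|^2 gives p x - q y = r (x^2 + y^2): a line through 0
   when r = 0, and otherwise a circle through 0, by completing the square.  The
   points 0 and infinity are exchanged. *)
Require Import Defs.
From mathcomp Require Import all_boot all_order all_algebra.
From mathcomp Require Import all_classical all_reals all_analysis.
From mathcomp Require Import complex ring.

Import Order.TTheory GRing.Theory Num.Theory.
Local Open Scope classical_set_scope.
Local Open Scope ring_scope.

Section Inversion.
Variable R : realType.
Implicit Types (A B : set R[i]) (X : set (sphere R)) (z w : R[i]).

Lemma iota_invK : involutive (@iota_inv R).
Proof.
case=> [z|] /=; last by rewrite eqxx.
case: eqVneq => [->|z0] //=.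
by rewrite invr_eq0 (negPf z0) invrK.
Qed.

(** As [iota_inv] is its own inverse, images can be traded for preimages, where membership is
    checked by evaluation and needs no witness. *)
Lemma image_iota_inv X : @iota_inv R @` X = @iota_inv R @^-1` X.
Proof.
apply/seteqP; split=> [_ [w Xw <-]|w Xw] /=; first by rewrite iota_invK.
by exists (iota_inv w) => //; exact: iota_invK.
Qed.

Lemma in_sphere_fin A z : in_sphere A (fin_pt z) <-> A z.
Proof. by split=> [[w Aw [<-]]|Az] //; exists z. Qed.

Lemma in_sphere_infty A : ~ in_sphere A (infty_pt R).
Proof. by case. Qed.

Lemma with_infty_fin A z : with_infty A (fin_pt z) <-> A z.
Proof.
by split=> [[/in_sphere_fin|]|Az] //; left; apply/in_sphere_fin.
Qed.

Lemma with_infty_infty A : with_infty A (infty_pt R).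
Proof. by right. Qed.

(** [B] stands for the equation of [A] at the inverse, cleared of denominators so that it also makes
    sense at 0. The hypothesis [B 0] reflects that 0 is the image of infinity. Infinity is the image
    of 0, so it lies in the image exactly when 0 lies in [A]. *)
Lemma image_iota_inv_with_infty A B :
    B 0 -> (forall z, z != 0 -> A z^-1 <-> B z) ->
  @iota_inv R @` with_infty A = if 0 \in A then with_infty B else in_sphere B.
Proof.
move=> B0 AB; rewrite image_iota_inv; apply/seteqP.
case: ifPn => [/set_mem A0|/negP A0]; split=> -[z|] /=.
- case: eqVneq => [-> _|z0 /with_infty_fin /AB-/(_ z0) Bz];
    exact/with_infty_fin.
- by move=> _; exact: with_infty_infty.
- case: eqVneq => [_ _|z0 /with_infty_fin Bz]; first exact: with_infty_infty.
  exact/with_infty_fin/AB.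
- by move=> _; exact/with_infty_fin.
- case: eqVneq => [-> _|z0 /with_infty_fin /AB-/(_ z0) Bz];
    exact/in_sphere_fin.
- by move=> /with_infty_fin /mem_set.
- case: eqVneq => [_ _|z0 /in_sphere_fin Bz]; first exact: with_infty_infty.
  exact/with_infty_fin/AB.
- by move/in_sphere_infty.
Qed.

(** Leaving out infinity before the inversion amounts to leaving out its image 0 afterwards. This
    reduces the claims on [in_sphere L] to those on [with_infty L]. *)
Lemma image_iota_inv_in_sphere A :
  @iota_inv R @` in_sphere A = @iota_inv R @` with_infty A `\ fin_pt 0.
Proof.
have -> : in_sphere A = with_infty A `\ infty_pt R.
  apply/seteqP; split=> [w Aw|w [[]//]].
  by split; [left|move=> /= w0; move: Aw; rewrite w0 => /in_sphere_infty].
rewrite !image_iota_inv; apply/seteqP; split=> w [Aw w0]; split=> // E;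
  apply: w0; first by rewrite /= E /= eqxx.
by rewrite /= -(iota_invK w) E.
Qed.

Lemma Re_inv z : complex.Re z^-1 =
  complex.Re z / (complex.Re z ^+ 2 + complex.Im z ^+ 2).
Proof. by case: z. Qed.

Lemma Im_inv z : complex.Im z^-1 =
  - complex.Im z / (complex.Re z ^+ 2 + complex.Im z ^+ 2).
Proof. by case: z => x y; rewrite mulNr. Qed.

Lemma sqr_ReIm_neq0 z :
  z != 0 -> complex.Re z ^+ 2 + complex.Im z ^+ 2 != 0.
Proof.
case: z => x y; apply: contraNneq => /= /eqP.
rewrite paddr_eq0 ?sqr_ge0// !sqrf_eq0 => /andP[/eqP -> /eqP ->].
by [].
Qed.

Lemma line_inv (p q r : R) z : z != 0 ->
  p * complex.Re z^-1 + q * complex.Im z^-1 = r <->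
  p * complex.Re z - q * complex.Im z =
    r * (complex.Re z ^+ 2 + complex.Im z ^+ 2).
Proof.
move=> /sqr_ReIm_neq0 n0; rewrite Re_inv Im_inv.
split=> [<-|E]; first by field.
by apply: (mulIf n0); rewrite -E; field.
Qed.

Lemma circle_eqnE (p q r x y : R) : r != 0 ->
  ((x - p / (2 * r)) ^+ 2 + (y + q / (2 * r)) ^+ 2 ==
     (p ^+ 2 + q ^+ 2) / (2 * r) ^+ 2) =
  (p * x - q * y == r * (x ^+ 2 + y ^+ 2)).
Proof.
move=> r0; rewrite -subr_eq0 -[RHS]subr_eq0.
set lhs := (X in X == 0); set rhs := (X in _ = (X == 0)).
(* Expanding the squares, the constants [p ^+ 2 / (2 * r) ^+ 2] and [q ^+ 2 / (2 * r) ^+ 2] cancel;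
   what remains is [rhs] up to the nonzero factor [- 1 / r]. *)
have -> : lhs = - rhs / r by rewrite /lhs /rhs; field.
by rewrite mulf_eq0 invr_eq0 (negPf r0) orbF oppr_eq0.
Qed.

Lemma image_iota_inv_affine_line (p q r : R) : r != 0 ->
  @iota_inv R @` with_infty
    [set z | p * complex.Re z + q * complex.Im z = r] =
  in_sphere [set z |
    (complex.Re z - p / (2 * r)) ^+ 2 + (complex.Im z + q / (2 * r)) ^+ 2
      = (p ^+ 2 + q ^+ 2) / (2 * r) ^+ 2].
Proof.
move=> r0; set A := [set z | _ = r]; set C := [set z | _ = _ / _].
have CE z : C z <-> p * complex.Re z - q * complex.Im z =
    r * (complex.Re z ^+ 2 + complex.Im z ^+ 2).
  by split=> /eqP; [rewrite circle_eqnE// => /eqP|rewrite -circle_eqnE// => /eqP].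
rewrite (@image_iota_inv_with_infty A C).
(* If 0 were on the line, its equation would give [r = 0]; hence infinity is not in the image. *)
- case: ifPn => // /set_mem /=; rewrite /A /= !mulr0 addr0 => /esym/eqP.
  by rewrite (negPf r0).
- by apply/CE => /=; ring.
- by move=> z z0; apply: iff_trans (iff_sym (CE z)); exact: line_inv.
Qed.

(** The line passes through 0, so its image keeps infinity; on finite points the effect is the
    reflection in the real axis. *)
Lemma image_iota_inv_linear_line (p q : R) :
  @iota_inv R @` with_infty
    [set z | p * complex.Re z + q * complex.Im z = 0] =
  with_infty [set z | p * complex.Re z - q * complex.Im z = 0].
Proof.
set A := [set z | _ + _ = 0]; set B := [set z | _ - _ = 0].
rewrite (@image_iota_inv_with_infty A B).
- by rewrite mem_set //= /A /= !mulr0 addr0.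
- by rewrite /B /= !mulr0 subr0.
- by move=> z z0; rewrite /A /B /= line_inv// mul0r.
Qed.

Lemma is_circle_eqn (u v r : R) : r != 0 ->
  is_circle (in_sphere [set z : R[i] |
    (complex.Re z - u) ^+ 2 + (complex.Im z - v) ^+ 2 = r ^+ 2]).
Proof.
(* [r] may be negative, as [1 / (2 * c)] is for negative [c], so the radius is its absolute
   value. *)
move=> r0; exists (Complex u v), `|r|; split; first by rewrite normr_gt0.
congr in_sphere; apply/seteqP; split=> -[x y] /=; rewrite normc_def /=.
  by move=> ->; rewrite sqrtr_sqr.
move=> [E]; rewrite -[RHS]real_normK ?num_real// -E sqr_sqrtr//.
by rewrite addr_ge0 ?sqr_ge0.
Qed.

End Inversion.

Theorem theorem6 (R : realType) (L : set R[i]) (hL : is_line L) :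
  [/\ (* (1) *)
      forall a b : R, b != 0 ->
        L = [set z | complex.Im z = a * complex.Re z + b] ->
        let C := [set z : R[i] |
          (complex.Re z + a / (2 * b)) ^+ 2 + (complex.Im z + 1 / (2 * b)) ^+ 2
            = (Num.sqrt (1 + a ^+ 2) / (2 * b)) ^+ 2] in
        [/\ is_circle (@iota_inv R @` with_infty L),
            @iota_inv R @` with_infty L = in_sphere C
          & @iota_inv R @` in_sphere L = in_sphere C `\ fin_pt 0],
      (* (2) *)
      forall a : R,
        L = [set z | complex.Im z = a * complex.Re z] ->
        let M := [set z : R[i] | complex.Im z = - a * complex.Re z] in
        @iota_inv R @` in_sphere L = with_infty M `\ fin_pt 0 /\
        @iota_inv R @` with_infty L = with_infty M,
      (* (3) *)
      forall c : R, c != 0 ->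
        L = [set z | complex.Re z = c] ->
        let C := [set z : R[i] |
          (complex.Re z - 1 / (2 * c)) ^+ 2 + complex.Im z ^+ 2
            = (1 / (2 * c)) ^+ 2] in
        [/\ is_circle (@iota_inv R @` with_infty L),
            @iota_inv R @` with_infty L = in_sphere C
          & @iota_inv R @` in_sphere L = in_sphere C `\ fin_pt 0]
    & (* (4) *)
      L = [set z | complex.Re z = 0] ->
      let M := [set z : R[i] | complex.Re z = 0] in
      @iota_inv R @` in_sphere L = with_infty M `\ fin_pt 0 /\
      @iota_inv R @` with_infty L = with_infty M].
Proof.
split=> [a b b0 -> C|a -> M|c c0 -> C|-> M].
- rewrite image_iota_inv_in_sphere.
  have -> : [set z | complex.Im z = a * complex.Re z + b] =
      [set z : R[i] | - a * complex.Re z + 1 * complex.Im z = b].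
    apply/seteqP; split=> z /=; rewrite mul1r mulNr; first by move=> ->; ring.
    by move=> <-; ring.
  rewrite image_iota_inv_affine_line//; set D := [set z | _].
  have -> : D = C.
    (* Here [p = - a] and [q = 1], so [p ^+ 2 + q ^+ 2] is [1 + a ^+ 2], the square of the root in
       [C]. *)
    rewrite /D /C expr_div_n sqr_sqrtr ?addr_ge0 ?sqr_ge0//.
    by rewrite sqrrN expr1n addrC mulNr opprK.
  split=> //; have -> : C = [set z : R[i] |
      (complex.Re z - - (a / (2 * b))) ^+ 2 +
      (complex.Im z - - (1 / (2 * b))) ^+ 2
        = (Num.sqrt (1 + a ^+ 2) / (2 * b)) ^+ 2] by rewrite !opprK.
  apply: is_circle_eqn; rewrite mulf_neq0 ?invr_eq0 ?mulf_neq0 ?pnatr_eq0//.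
  by rewrite gt_eqF// sqrtr_gt0 ltr_wpDr ?sqr_ge0.
- rewrite image_iota_inv_in_sphere.
  have -> : [set z | complex.Im z = a * complex.Re z] =
      [set z : R[i] | - a * complex.Re z + 1 * complex.Im z = 0].
    apply/seteqP; split=> z /=; rewrite mul1r mulNr addrC.
      by move=> ->; rewrite subrr.
    exact: subr0_eq.
  rewrite image_iota_inv_linear_line.
  suff -> : [set z | - a * complex.Re z - 1 * complex.Im z = 0] = M by [].
  apply/seteqP; split=> z; rewrite /M /= mul1r; first by move/subr0_eq.
  by move=> ->; rewrite subrr.
- rewrite image_iota_inv_in_sphere.
  (* A vertical line has [q = 0], which puts the centre of the image circle on the real axis. *)
  have -> : [set z | complex.Re z = c] =
      [set z : R[i] | 1 * complex.Re z + 0 * complex.Im z = c].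
    by under [RHS]eq_set => z do rewrite mul1r mul0r addr0.
  rewrite image_iota_inv_affine_line//; set D := [set z | _].
  have -> : D = C.
    rewrite /D /C expr1n expr0n addr0 expr_div_n expr1n.
    by under eq_set => z do rewrite mul0r addr0.
  split=> //; have -> : C = [set z : R[i] |
      (complex.Re z - 1 / (2 * c)) ^+ 2 + (complex.Im z - 0) ^+ 2
        = (1 / (2 * c)) ^+ 2] by under [RHS]eq_set => z do rewrite subr0.
  apply: is_circle_eqn.
  by rewrite mulf_neq0 ?oner_eq0 ?invr_eq0 ?mulf_neq0 ?pnatr_eq0.
- rewrite image_iota_inv_in_sphere.
  (* With [q = 0] the reflection in the real axis fixes the line, so [M] is the same set as the
     line. *)
  have E : [set z | complex.Re z = 0] =
      [set z : R[i] | 1 * complex.Re z + 0 * complex.Im z = 0].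
    by under [RHS]eq_set => z do rewrite mul1r mul0r addr0.
  rewrite E image_iota_inv_linear_line.
  suff -> : [set z | 1 * complex.Re z - 0 * complex.Im z = 0] = M by [].
  by under eq_set => z do rewrite mul1r mul0r subr0.
Qed.
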